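(* Suppose $f\in C([0,1]^d)$ belongs to $KL$. Let $g$ be the associated (Lipschitz continuous) K-outer function with Lipschitz constant $C_g$, and let $C_\phi$ be the common Lipschitz constant of the K-inner functions $\phi_q$, $q=0,1,\dots,2d$ (i.e. $\phi_q\in \mathrm{Lip}_{C_\phi}(\alpha)$ for all $q$). Then, for every positive integer $p$ and every $N\in\mathbb{N}$ with $N>5$, $$\inf_{s\in \mathcal{K}_{p,N}^{\sigma_1}}\|f-s\|_{C([0,1]^d)}\le C_g(2d+1)d\left(\frac{21}{N}+\frac{3KC_\phi}{p^{\alpha}}\right),\qquad \alpha=\log_{10}2.$$
   Context: Hölder classes: for $M\ge 0$, $0<\alpha\le 1$, a function $h:[a,b]\to\mathbb{R}$ belongs to $\mathrm{Lip}_M(\alpha)$ if $|h(x)-h(y)|\le M|x-y|^\alpha$ for all $x,y\in[a,b]$; $\mathrm{Lip}(\alpha)=\bigcup_{M}\mathrm{Lip}_M(\alpha)$. $\|\cdot\|_{C([0,1]^d)}$ is the sup norm. Kolmogorov superposition setting (Lorentz version; known theorem): fix irrational numbers $0<\lambda_i\le 1$ ($i=1,\dots,d$) and strictly increasing functions $\phi_q:[0,1]\to[0,1]$ ($q=0,\dots,2d$) in $\mathrm{Lip}(\alpha)$ with $\alpha=\log_{10}2$, independent of $f$, such that for every $f\in C([0,1]^d)$ there is a continuous $g:[0,d]\to\mathbb{R}$ with $$f(x_1,\dots,x_d)=\sum_{q=0}^{2d} g\Big(\sum_{i=1}^d\lambda_i\phi_q(x_i)\Big)\quad\text{for all }(x_1,\dots,x_d)\in[0,1]^d.$$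 The $\phi_q$ are called the K-inner functions and $g$ the K-outer function associated with $f$. $$KL=\{f\in C([0,1]^d): \text{the K-outer function } g \text{ of } f \text{ is Lipschitz continuous}\}.$$ Constants: $K$ is the positive constant of Jackson's theorem on $[0,1]$, i.e. an absolute constant such that for all $M\ge0$, $0<\beta\le1$, $h\in\mathrm{Lip}_M(\beta)$ on $[0,1]$ and $p\ge1$ there is a real polynomial $r$ of degree at most $p$ with $\max_{x\in[0,1]}|h(x)-r(x)|\le KM/p^{\beta}$. Put $\Delta=KC_\phi/p^{\alpha}$. Network class: $\sigma_1=\tanh$. Let $x_1,\dots,x_{p+1}$ be the Gauss-Lobatto-Legendre points in $[0,1]$ and $\psi_j(x)=\prod_{i=1,i\ne j}^{p+1}\frac{x-x_i}{x_j-x_i}$, $j=1,\dots,p+1$, the Lagrange basis polynomials. $\mathcal{K}_{p,N}^{\sigma_1}$ is the set of all functions on $[0,1]^d$ of the form $$(x_1,\dots,x_d)\mapsto\sum_{q=0}^{2d}\hat g^N\Big(\sum_{i=1}^d\lambda_i\bar L_q(x_i)\Big),\qquad \bar L_q(x)=w\,\sigma_1\left(\frac{\sum_{j=1}^{p+1}a_{j,q}\psi_j(x)+\Delta}{w(1+2\Delta)}\right),$$ with free parameters $a_{j,q}\in\mathbb{R}$, $\lambda_i\in(0,1]$ (free network parameters here), a scalar $w>0$, and $\hat g^N:\mathbb{R}\to\mathbb{R}$ any tanh neural network with two hidden layers, one of width at most $N-1$ and the other of width at most $6N$. A tanh neural network with two hidden layers is a map $A_3\circ\tanh\circ A_2\circ\tanh\circ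 A_1$ with affine maps $A_1,A_2,A_3$ and $\tanh$ applied componentwise. *)

(* Defs.v *)
From HB Require Import structures.
From mathcomp Require Import all_boot all_order all_algebra.
From mathcomp Require Import all_classical all_reals all_analysis.
Set Implicit Arguments.
Unset Strict Implicit.
Unset Printing Implicit Defensive.
Import Order.TTheory GRing.Theory Num.Theory.
Import numFieldNormedType.Exports.
Local Open Scope classical_set_scope.
Local Open Scope ring_scope.

(* Functions on [a, b] (resp. on the unit cube) are total functions on R
   (resp. on 'rV[R]_d) of which only the restriction to that set matters. *)

Section Functions.
Context {R : realType}.
Implicit Types (M alpha a b : R) (h : R -> R).

Definition in_LipM M alpha a b h : Prop :=
  forall x y, x \in `[a, b] -> y \in `[a, b] ->
    `|h x - h y| <= M * `|x - y| `^ alpha.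

Definition in_Lip alpha a b h : Prop :=
  exists2 M, 0 <= M & in_LipM M alpha a b h.

Definition log10_2 : R := ln 2 / ln 10.

Definition cube (d : nat) : set 'rV[R]_d :=
  [set x | forall i, x 0 i \in `[0, 1]].
Arguments cube d : clear implicits.

Definition in_C d (f : 'rV[R]_d -> R) : Prop :=
  {within cube d, continuous f}.

(* Extended-real valued, so that an unbounded function has norm +oo rather
   than the default value of [sup]. *)
Definition sup_norm d (f : 'rV[R]_d -> R) : \bar R :=
  ereal_sup [set `|f x|%:E | x in cube d].

(* K has the property required of the constant in Jackson's theorem; recall
   that the degree of r is (size r).-1. *)
Definition is_jackson_constant (K : R) : Prop :=
  0 < K /\
  forall M (beta : R) h (p : nat),
    0 <= M -> 0 < beta <= 1 -> in_LipM M beta 0 1 h -> (0 < p)%N ->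
    exists2 r : {poly R}, (size r <= p.+1)%N &
      forall x, x \in `[0, 1] -> `|h x - r.[x]| <= K * M / p%:R `^ beta.

End Functions.

Arguments cube {R} d.

Section Kolmogorov.
Context {R : realType} (d : nat).
Implicit Types (lambda : 'I_d -> R) (phi : 'I_(2 * d).+1 -> R -> R).
Implicit Types (f : 'rV[R]_d -> R) (g : R -> R).

Definition is_outer lambda phi f g : Prop :=
  {within `[0, d%:R], continuous g} /\
  forall x, cube d x ->
    f x = \sum_(q < (2 * d).+1) g (\sum_(i < d) lambda i * phi q (x 0 i)).

Record kolmogorov_system lambda phi : Prop := KolmogorovSystem {
  lambda_itv : forall i, 0 < lambda i <= 1;
  lambda_irrational : forall i, irrational (lambda i);
  phi_itv : forall q x, x \in `[0, 1] -> phi q x \in `[0, 1];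
  phi_incr : forall q,
    {in `[0, 1] &, {homo phi q : x y / x < y}};
  phi_Lip : forall q, in_Lip log10_2 0 1 (phi q);
  superposition : forall f, in_C f -> exists g, is_outer lambda phi f g
}.

(* The outer function of f need not be unique: f belongs to KL when one of its
   outer functions is Lipschitz. *)
Definition KL lambda phi : set ('rV[R]_d -> R) :=
  [set f | in_C f /\ exists2 g, is_outer lambda phi f g &
                      [lipschitz g t | t in `[0, d%:R]]].

End Kolmogorov.

Section GaussLobattoLegendre.
Context {R : realType}.

(* Rodrigues' formula. *)
Definition legendre (n : nat) : {poly R} :=
  (2 ^+ n * n`!%:R)^-1 *: (('X^2 - 1) ^+ n)^`(n).

(* On [-1, 1] the p + 1 points are the roots of (1 - t^2) P_p'(t), a polynomial
   of degree p + 1; t = 2 x - 1 transports them to [0, 1].  As the x i are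
   pairwise distinct, they are all the roots. *)
Definition is_gll_points (p : nat) (x : 'I_p.+1 -> R) : Prop :=
  (forall i j : 'I_p.+1, (i < j)%N -> x i < x j) /\
  forall i, let t := 2 * x i - 1 in (1 - t ^+ 2) * (legendre p)^`().[t] = 0.

Definition lagrange_basis (p : nat) (x : 'I_p.+1 -> R) (j : 'I_p.+1) (t : R)
    : R :=
  \prod_(i < p.+1 | i != j) ((t - x i) / (x j - x i)).

End GaussLobattoLegendre.

Section Networks.
Context {R : realType}.

Definition tanh (x : R) : R :=
  (expR x - expR (- x)) / (expR x + expR (- x)).

Definition affine m n (A : 'M[R]_(m, n)) (b : 'cV[R]_m) (v : 'cV[R]_n)
    : 'cV[R]_m :=
  A *m v + b.

Definition tanh_net2 (n1 n2 : nat)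
    (A1 : 'M[R]_(n1, 1)) (b1 : 'cV[R]_n1)
    (A2 : 'M[R]_(n2, n1)) (b2 : 'cV[R]_n2)
    (A3 : 'M[R]_(1, n2)) (b3 : 'cV[R]_1) (t : R) : R :=
  affine A3 b3 (map_mx tanh (affine A2 b2 (map_mx tanh
    (affine A1 b1 (const_mx t))))) 0 0.

(* Which of the two hidden layers is the narrow one is left open. *)
Definition outer_net (N : nat) : set (R -> R) :=
  [set ghat | exists n1 n2 : nat,
     ((n1 <= N - 1) && (n2 <= 6 * N) || (n1 <= 6 * N) && (n2 <= N - 1))%N /\
     exists A1 b1 A2 b2 A3 b3, ghat = @tanh_net2 n1 n2 A1 b1 A2 b2 A3 b3].

Definition inner_net (p : nat) (x : 'I_p.+1 -> R) (Delta w : R)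
    (a : 'I_p.+1 -> R) (t : R) : R :=
  w * tanh ((\sum_(j < p.+1) a j * lagrange_basis x j t + Delta)
            / (w * (1 + 2 * Delta))).

Definition Knet (d p N : nat) (x : 'I_p.+1 -> R) (Delta : R)
    : set ('rV[R]_d -> R) :=
  [set s | exists (lambda : 'I_d -> R) (w : R)
             (a : 'I_(2 * d).+1 -> 'I_p.+1 -> R) (ghat : R -> R),
     [/\ forall i, 0 < lambda i <= 1, 0 < w, outer_net N ghat &
         forall y, cube d y ->
           s y = \sum_(q < (2 * d).+1)
                   ghat (\sum_(i < d) lambda i
                           * inner_net x Delta w (a q) (y 0 i))]].

End Networks.

Arguments Knet {R} d {p} N x Delta.

(* Main.v *)
Require Import Defs.
From HB Require Import structures.
From mathcomp Require Import all_boot all_order all_algebra.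
From mathcomp Require Import ring lra.
From mathcomp Require Import all_classical all_reals all_analysis.
Import Order.TTheory GRing.Theory Num.Theory.
Import numFieldNormedType.Exports.
Local Open Scope classical_set_scope.
Local Open Scope ring_scope.

(** Keep the weights lambda of the superposition formula, replace every inner
    function phi_q by a network L_q and the outer function g by a network ghat.
    If L_q maps [0, 1] to itself and is 3 Delta-close to phi_q, then both
    u = sum_i lambda_i phi_q (x_i) and v = sum_i lambda_i L_q (x_i) lie in
    [0, d] and |u - v| <= 3 d Delta, whence
      |g u - ghat v| <= Cg |u - v| + |g v - ghat v|
                     <= 3 Cg d Delta + |g v - ghat v|.
    Summing over the 2 d + 1 values of q gives the theorem, as soon as ghat is
    within Cg 21 d / N of g on [0, d].

    Inner networks ([inner_approx]).  Jackson's theorem gives a polynomial r of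
    degree at most p which is Delta-close to phi_q.  It is the sum of the
    r(x_j) psi_j, whatever the distinct nodes x_j are
    ([lagrange_interpolation]), so these values are used as parameters.  As r
    takes its values in [- Delta, 1 + Delta], z = (r + Delta) / (1 + 2 Delta)
    lies in [0, 1], and it is 2 Delta-close to phi_q.  Finally
    z - z^2 / w <= w tanh (z / w) <= z ([scaled_tanh]): tanh never pushes z out
    of [0, 1], and moves it by at most Delta when w = 1 / Delta.

    Outer network ([outer_approx]).  Cut [0, d] into N equal pieces and replace
    g by a staircase whose jumps are the increments of g over the pieces.  A
    neuron of the second layer, fed with the single number tanh t by a first
    layer of width 1, is as sharp a step as one likes ([soft_step]), because
    tanh is strictly increasing.  The widths are thus 1 and N.  For t in a
    given piece the other N - 1 steps contribute errors proportional to their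
    sharpness, chosen to be 1 / N, and the remaining one is off by at most
    twice the oscillation bound Cg d / N: the total is at most 3 Cg d / N.
    All errors are proportional to Cg, so that Cg = 0 is not special. *)

(** * The hyperbolic tangent *)

Section Tanh.
Context {R : realType}.
Implicit Types x y z w a b eta : R.

Lemma tanhE x : tanh x = 1 - 2 / (expR (2 * x) + 1).
Proof.
have e0 := expR_gt0 x; have E : expR (2 * x) = expR x ^+ 2 by rewrite expRM_natl.
rewrite /tanh expRN E; field.
have H : 0 < expR x ^+ 2 + 1 by rewrite ltr_wpDl ?sqr_ge0.
have H' : 0 < expR x * expR x + 1 by rewrite -expr2.
by rewrite !gt_eqF.
Qed.

Lemma tanh_homo : {homo (@tanh R) : x y / x < y}.
Proof.
move=> x y xy; rewrite !tanhE ltrD2l ltrN2.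
have ex := expR_gt0 (2 * x); have ey := expR_gt0 (2 * y).
rewrite ltr_pM2l // ltf_pV2 ?posrE ?addr_gt0 // ltrD2r ltr_expR; lra.
Qed.

Lemma tanh_le : {mono (@tanh R) : x y / x <= y}.
Proof. exact: le_mono tanh_homo. Qed.

Lemma tanhN x : tanh (- x) = - tanh x.
Proof. by rewrite /tanh opprK -mulNr opprB [_ + expR x]addrC. Qed.

Lemma tanh0 : tanh (0 : R) = 0.
Proof. by rewrite /tanh oppr0 subrr mul0r. Qed.

Lemma tanh_ge0 x : 0 <= x -> 0 <= tanh x.
Proof. by move=> x0; rewrite -tanh0 tanh_le. Qed.

Lemma tanh_lt1 x : tanh x < 1.
Proof. by rewrite tanhE ltrBlDr ltrDl divr_gt0 // addr_gt0 ?expR_gt0. Qed.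

Lemma tanh_gtN1 x : - 1 < tanh x.
Proof. by rewrite ltrNl -tanhN tanh_lt1. Qed.

(** Since exp (2 x) >= 1 + 2 x.  The lower bound equals x / (1 + x): it serves
    both for large x, where it tends to 1, and for small x, where it is
    x + O(x^2). *)
Lemma tanh_geV x : 0 <= x -> 1 - (1 + x)^-1 <= tanh x.
Proof.
move=> x0; rewrite tanhE lerD2l lerN2.
have e := expR_ge1Dx (2 * x).
have -> : (1 + x)^-1 = 2 / (2 * (1 + x)) by field; lra.
rewrite ler_pM2l // lef_pV2 ?posrE; lra.
Qed.

Lemma tanh_le_id x : 0 <= x -> tanh x <= x.
Proof.
move=> x0.
(* The derivative of y - tanh y is tanh^2 y. *)
pose F (y : R) := y - tanh y.
have dF (y : R) : is_derive y 1 F (tanh y ^+ 2).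
  have e0 := expR_gt0 y; have e1 := expR_gt0 (- y).
  have n0 : expR y + expR (- y) != 0 by rewrite gt_eqF ?addr_gt0.
  rewrite /F /tanh; apply: is_derive_eq.
  rewrite /GRing.scale /=; field. by [].
have : F 0 <= F x.
  apply: (@ger0_derive1_ndecr _ F 0 x) => //.
  - by move=> y _; rewrite derive1E; case: (dF y) => _ ->; rewrite sqr_ge0.
  - apply: derivable_within_continuous => y _; by case: (dF y).
by rewrite /F tanh0 subr0 subr_ge0.
Qed.

(** A tanh neuron with a large scale w is nearly the identity; the upper bound
    is exact, which keeps the values of the inner networks in [0, 1]. *)
Lemma scaled_tanh z w : 0 < w -> 0 <= z ->
  z - z ^+ 2 / w <= w * tanh (z / w) <= z.
Proof.
move=> w0 z0; have zw0 : 0 <= z / w by rewrite divr_ge0 // ltW.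
apply/andP; split; last first.
  by rewrite mulrC -ler_pdivlMr // tanh_le_id.
apply: (@le_trans _ _ (w * (1 - (1 + z / w)^-1))); last first.
  by rewrite ler_pM2l // tanh_geV.
have zw1 : 0 < w + z by lra.
have -> : w * (1 - (1 + z / w)^-1) = z - z ^+ 2 / (w + z).
  by field; rewrite !gt_eqF.
rewrite lerD2l lerN2 ler_wpM2l ?sqr_ge0 // lef_pV2 ?posrE; lra.
Qed.

(** Since tanh a < tanh b, an affine map k (tanh t - m), with m the midpoint of
    tanh a and tanh b, is at most - 1 / eta for t <= a and at least 1 / eta for
    t >= b, if k is large; another tanh makes this an approximate step. *)
Lemma soft_step a b eta : a < b -> 0 < eta ->
  exists kc : R * R, let s t := (1 + tanh (kc.1 * tanh t + kc.2)) / 2 in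
  [/\ forall t, 0 <= s t <= 1, forall t, t <= a -> s t <= eta
    & forall t, b <= t -> 1 - eta <= s t].
Proof.
move=> ab eta0; have tab := tanh_homo _ _ ab.
pose m := (tanh a + tanh b) / 2; pose h := (tanh b - tanh a) / 2.
have h0 : 0 < h by rewrite /h; lra.
pose k := (eta * h)^-1; have k0 : 0 < k by rewrite invr_gt0 mulr_gt0.
have kh : k * h = eta^-1 by rewrite /k; field; rewrite !gt_eqF.
have ei0 : 0 < eta^-1 by rewrite invr_gt0.
have big (u : R) : eta^-1 <= u -> 1 - eta <= tanh u.
  move=> le_u; apply: (le_trans _ (tanh_geV _ _)); last by lra.
  rewrite lerD2l lerN2 -[leRHS]invrK lef_pV2 ?posrE; lra.
exists (k, - (k * m)) => /=; split=> t.
- have := tanh_lt1 (k * tanh t + - (k * m)).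
  have := tanh_gtN1 (k * tanh t + - (k * m)); lra.
- rewrite -tanh_le => ta.
  have : k * h <= k * (m - tanh t) by rewrite ler_pM2l // /m /h; lra.
  rewrite kh => /big.
  have -> : k * tanh t - k * m = - (k * (m - tanh t)) by ring.
  by rewrite tanhN; lra.
- rewrite -tanh_le => bt.
  have : k * h <= k * (tanh t - m) by rewrite ler_pM2l // /m /h; lra.
  by rewrite kh => /big; rewrite mulrBr; lra.
Qed.

End Tanh.

(** * Approximation of the outer function *)

Section OuterNetwork.
Context {R : realType}.

(** The narrow layer has a single neuron, which computes tanh t. *)
Lemma outer_net_steps N (k c v : 'I_N -> R) (v0 : R) : (1 < N)%N ->
  outer_net N (fun t => v0 + \sum_(j < N) v j * tanh (k j * tanh t + c j)).
Proof.
move=> N1; exists 1%N, N; split.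
  by rewrite leq_pmull // subn_gt0 N1.
exists 1%:M, 0, (\col_j k j), (\col_j c j), (\row_j v j), (const_mx v0).
apply/funext => t; rewrite /tanh_net2 /affine mul1mx addr0 !mxE addrC.
congr (_ + _); apply: eq_bigr => j _; rewrite !mxE big_ord1 !mxE; congr (_ * _).
Qed.

Lemma grid_interval (h t : R) n : (0 < n)%N -> 0 <= t <= n%:R * h ->
  exists2 k, (k < n)%N & k%:R * h <= t <= k.+1%:R * h.
Proof.
case: n => // n _; elim: n => [|n IH] /andP[t0 tn].
  by exists 0%N; rewrite // mul0r t0.
have [le_t|lt_t] := leP t (n.+1%:R * h).
  by have [|k kn tk] := IH; [rewrite t0|exists k; first exact: ltnW].
by exists n.+1; rewrite // tn ltW.
Qed.

(** The telescoping sum of the increments of g along the grid points, capped at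
    t, is compared term by term with the staircase: completed and future steps
    cost their sharpness 1 / N times C D / N, the current one 2 C D / N. *)
Lemma outer_approx (g : R -> R) (C D : R) N : (1 < N)%N -> 0 < D -> 0 <= C ->
  {in `[0, D] &, forall u v, `|g u - g v| <= C * `|u - v|} ->
  exists2 ghat, outer_net N ghat &
    {in `[0, D], forall t, `|g t - ghat t| <= C * (3 * D / N%:R)}.
Proof.
move=> N1 D0 C0 gC; have N0 : 0 < N%:R :> R by rewrite ltr0n ltnW.
pose h := D / N%:R; have h0 : 0 < h by rewrite divr_gt0.
have Nh : N%:R * h = D by rewrite /h mulrC divfK // gt_eqF.
pose T j : R := j%:R * h.
have T_le (i j : nat) : (i <= j)%N -> T i <= T j.
  by move=> ij; rewrite ler_pM2r // ler_nat.
have T0 : T 0%N = 0 by rewrite /T mul0r.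
have T_in (j : nat) : (j <= N)%N -> T j \in `[0, D].
  by move=> jN; rewrite in_itv /= -{1}T0 -Nh !T_le.
have TS (j : nat) : T j.+1 = T j + h by rewrite /T -natr1 mulrDl mul1r.
have step (j : 'I_N) : exists kc : R * R,
    let s t := (1 + tanh (kc.1 * tanh t + kc.2)) / 2 in
    [/\ forall t, 0 <= s t <= 1, forall t, t <= T j -> s t <= N%:R^-1
      & forall t, T j.+1 <= t -> 1 - N%:R^-1 <= s t].
  by apply: soft_step; rewrite ?invr_gt0 // TS ltrDl.
have [kc kcP] := choice step.
pose s (j : 'I_N) t := (1 + tanh ((kc j).1 * tanh t + (kc j).2)) / 2.
pose dg (j : nat) := g (T j.+1) - g (T j).
exists (fun t => g 0 + \sum_(j < N) dg j * s j t).
  have := @outer_net_steps N (fun j => (kc j).1) (fun j => (kc j).2)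
    (fun j => dg j / 2) (g 0 + \sum_(j < N) dg j / 2) N1.
  (* (1 + tanh) / 2 is a step from 0 to 1: half of each jump goes into the bias. *)
  congr outer_net; apply/funext => t; rewrite -addrA -big_split /=.
  by congr (_ + _); apply: eq_bigr => j _; rewrite /s; field.
(* m j is the j-th grid point capped at t: the increments of g o m vanish
   beyond t, and add up to g t - g 0. *)
move=> t tD; pose m j := Num.min t (T j).
have m_in (j : nat) : (j <= N)%N -> m j \in `[0, D].
  by move=> jN; rewrite /m /Num.min; case: ifP => // _; exact: T_in.
have [k kN /andP[Tkt tTk]] : exists2 k, (k < N)%N & T k <= t <= T k.+1.
  by apply: grid_interval; rewrite ?(ltnW N1) // Nh -[_ && _]/(t \in `[0, D]).
have -> : g t = g 0 + \sum_(j < N) (g (m j.+1) - g (m j)).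
  rewrite -(big_mkord xpredT (fun j => g (m j.+1) - g (m j))).
  rewrite telescope_sumr ?(ltnW N1) //.
  have /andP[t0 tD'] : 0 <= t <= D by [].
  rewrite /m T0 (min_idPr t0) [T N]Nh (min_idPl tD'); ring.
rewrite opprD addrACA subrr add0r -sumrB.
apply: (le_trans (ler_norm_sum _ _ _)).
have bound (j : 'I_N) : `|g (m j.+1) - g (m j) - dg j * s j t| <=
    C * h * (N%:R^-1 + 2 * (val j == k)%:R).
  have [/(_ t) s01 /(_ t) s0 /(_ t) s1] := kcP j; rewrite -/(s j t) in s01 s0 s1.
  have dgC : `|dg j| <= C * h.
    have := gC _ _ (T_in _ (ltn_ord j)) (T_in _ (ltnW (ltn_ord j))).
    have -> : T j.+1 - T j = h by rewrite TS addrC addKr.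
    by rewrite (gtr0_norm h0).
  have Ni0 : 0 < N%:R^-1 :> R by rewrite invr_gt0.
  have [jk|kj|jk] := ltngtP (val j) k.
  - have Tt := le_trans (T_le _ _ jk) Tkt.
    rewrite /m (min_idPr Tt) (min_idPr (le_trans (T_le _ _ (leqnSn _)) Tt)).
    rewrite mulr0 addr0 -/(dg j) -[X in `|X - _|]mulr1 -mulrBr normrM.
    rewrite ler_pM // ler_norml; have := s1 Tt; lra.
  - have tT := le_trans tTk (T_le _ _ kj).
    rewrite /m (min_idPl tT) (min_idPl (le_trans tT (T_le _ _ (leqnSn _)))).
    rewrite subrr sub0r normrN normrM mulr0 addr0 ler_pM // ger0_norm; last lra.
    exact: s0.
  - rewrite mulr1; apply: (le_trans (ler_normB _ _)).
    have m1 : `|g (m j.+1) - g (m j)| <= C * h.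
      apply: (le_trans (gC _ _ (m_in _ (ltn_ord j)) (m_in _ (ltnW (ltn_ord j))))).
      rewrite ler_wpM2l // /m jk (min_idPr Tkt) (min_idPl tTk).
      by rewrite ger0_norm; move: tTk; rewrite TS; lra.
    have m2 : `|dg j * s j t| <= C * h.
      rewrite normrM -[leRHS]mulr1 ler_pM //.
      by rewrite ger0_norm; case/andP: s01.
    have Ch : 0 <= C * h by rewrite mulr_ge0 // ltW.
    have := mulr_ge0 Ch (ltW Ni0).
    by rewrite mulrDr; lra.
apply: (le_trans (ler_sum _ (fun j _ => bound j))).
rewrite -mulr_sumr big_split /= sumr_const card_ord -mulr_sumr.
rewrite (bigD1 (Ordinal kN)) //= eqxx big1 => [|j]; last first.
  by rewrite -val_eqE /= => /negPf ->.
rewrite -[_ *+ N]mulr_natl mulfV ?gt_eqF // addr0 mulr1.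
have -> : C * (3 * D / N%:R) = C * h * 3 by rewrite /h; ring.
by rewrite ler_wpM2l ?mulr_ge0 ?(ltW h0) //; lra.
Qed.

End OuterNetwork.

(** * Approximation of the inner functions *)

Section InnerNetwork.
Context {R : realType}.

(** Both sides are polynomials in t of degree at most p which agree at p + 1
    distinct points. *)
Lemma lagrange_interpolation (p : nat) (x : 'I_p.+1 -> R) (r : {poly R}) t :
  injective x -> (size r <= p.+1)%N ->
  \sum_(j < p.+1) r.[x j] * lagrange_basis x j t = r.[t].
Proof.
move=> x_inj size_r.
pose ell j : {poly R} :=
  \prod_(i < p.+1 | i != j) ((x j - x i)^-1 *: ('X - (x i)%:P)).
have ellE j u : (ell j).[u] = lagrange_basis x j u.
  rewrite /ell horner_prod; apply: eq_bigr => i _.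
  by rewrite !hornerE mulrC.
have ell_node j i : lagrange_basis x j (x i) = (i == j)%:R.
  have [->|ij] := eqVneq i j.
    rewrite /lagrange_basis big1 // => k kj.
    by rewrite mulfV // subr_eq0 inj_eq // eq_sym.
  by rewrite /lagrange_basis (bigD1 i) //= subrr mul0r mul0r.
have size_ell j : (size (ell j) <= p.+1)%N.
  apply: (leq_trans (size_poly_prod_leq _ _)).
  apply: (@leq_trans ((\sum_(i < p.+1 | i != j) 2).+1 - #|predC1 j|)); last first.
    by rewrite sum_nat_const cardC1 card_ord /= muln2 -addnn -addSn addnK.
  rewrite leq_sub2r // ltnS leq_sum // => i _.
  by rewrite (leq_trans (size_scale_leq _ _)) // size_XsubC.
pose D := \sum_(j < p.+1) r.[x j] *: ell j - r.
have DE u : D.[u] = \sum_(j < p.+1) r.[x j] * lagrange_basis x j u - r.[u].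
  rewrite /D hornerD hornerN horner_sum; congr (_ - _).
  by apply: eq_bigr => j _; rewrite hornerZ ellE.
suff D0 : D = 0 by apply/eqP; rewrite -subr_eq0 -DE D0 horner0.
apply: (@roots_geq_poly_eq0 _ D (map x (enum 'I_p.+1))).
- apply/allP => _ /mapP[i _ ->]; rewrite rootE DE (bigD1 i) //= ell_node eqxx.
  rewrite big1 ?mulr1 ?addr0 ?subrr // => j ji.
  by rewrite ell_node eq_sym (negPf ji) mulr0.
- by rewrite map_inj_uniq ?enum_uniq.
- rewrite size_map size_enum_ord; apply: (leq_trans (size_polyD _ _)).
  rewrite size_polyN geq_max size_r andbT.
  apply: (leq_trans (size_sum _ _ _)); apply/bigmax_leqP => j _.
  by rewrite (leq_trans (size_scale_leq _ _)).
Qed.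

(** The affine rescaling brings the polynomial, known to lie in
    [- Delta, 1 + Delta], back to [0, 1] at a cost of 2 Delta at most; the scale
    w = 1 / Delta then makes tanh cost at most Delta more. *)
Lemma inner_approx (p : nat) (x : 'I_p.+1 -> R) (r : {poly R}) (phi Delta t : R) :
  injective x -> (size r <= p.+1)%N -> 0 < Delta -> 0 <= phi <= 1 ->
  `|phi - r.[t]| <= Delta ->
  let L := inner_net x Delta Delta^-1 (fun j => r.[x j]) t in
  0 <= L <= 1 /\ `|phi - L| <= 3 * Delta.
Proof.
move=> x_inj size_r De0 phi01 close /=.
rewrite /inner_net lagrange_interpolation //.
set y := r.[t] in close *; pose z := (y + Delta) / (1 + 2 * Delta).
have wz : (y + Delta) / (Delta^-1 * (1 + 2 * Delta)) = z * Delta.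
  by rewrite /z; field; rewrite !gt_eqF //; lra.
rewrite wz.
have q0 : 0 < 1 + 2 * Delta by lra.
move: close; rewrite ler_norml => close.
have z01 : 0 <= z <= 1.
  by rewrite divr_ge0 ?ler_pdivrMr // ?mul1r; lra.
have /andP[z0 z1] := z01.
have phiz : `|phi - z| <= 2 * Delta.
  (* 2 phi - 1 lies in [-1, 1]. *)
  have -> : phi - z = (phi - y + Delta * (2 * phi - 1)) / (1 + 2 * Delta).
    by rewrite /z; field; rewrite gt_eqF.
  rewrite normrM normfV (gtr0_norm q0) ler_pdivrMr //.
  by rewrite ler_norml; apply/andP; split; nra.
have := @scaled_tanh R z Delta^-1; rewrite !invrK invr_gt0 => /(_ De0 z0).
move=> /andP[lo hi].
have tz0 : 0 <= Delta^-1 * tanh (z * Delta).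
  by apply: mulr_ge0; [|apply: tanh_ge0; apply: mulr_ge0 => //];
    rewrite ?invr_ge0 ltW.
move: phiz; rewrite !ler_norml => phiz.
have z2 : z ^+ 2 * Delta <= Delta.
  by rewrite ler_piMl ?(ltW De0) // exprn_ile1.
split; lra.
Qed.

End InnerNetwork.

(** * Assembly of the two approximations *)

Lemma log10_2_itv {R : realType} : 0 < (log10_2 : R) <= 1.
Proof.
have l2 : 0 < ln 2 :> R by rewrite ln_gt0 // ltr1n.
have l10 : 0 < ln 10 :> R by rewrite ln_gt0 // ltr1n.
by rewrite divr_gt0 //= ler_pdivrMr // mul1r ler_ln ?posrE // ler_nat.
Qed.

Lemma ereal_inf_le_dist {R : realType} d (f s : 'rV[R]_d -> R)
    (S : set ('rV[R]_d -> R)) (e : R) :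
  S s -> (forall y, cube d y -> `|f y - s y| <= e) ->
  (ereal_inf [set sup_norm (fun y => f y - s y)%R | s in S] <= e%:E)%E.
Proof.
move=> Ss close; apply: (@le_trans _ _ (sup_norm (fun y => f y - s y))).
  by apply: ereal_inf_lbound; exists s.
by apply: ge_ereal_sup => _ [y /close y_e <-]; rewrite lee_fin.
Qed.

Lemma weighted_sum_itv {R : realType} d (lambda v : 'I_d -> R) :
  (forall i, 0 < lambda i <= 1) -> (forall i, 0 <= v i <= 1) ->
  \sum_(i < d) lambda i * v i \in `[0, d%:R].
Proof.
move=> l01 v01; rewrite in_itv /=; apply/andP; split.
  apply: sumr_ge0 => i _; have /andP[/ltW l0 _] := l01 i.
  by have /andP[v0 _] := v01 i; rewrite mulr_ge0.
rewrite -[leRHS](mulr1n d%:R) -[d in leRHS]card_ord -sumr_const.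
apply: ler_sum => i _; have /andP[/ltW l0 l1] := l01 i.
by have /andP[v0 v1] := v01 i; rewrite mulr_ile1.
Qed.

Lemma weighted_sum_dist {R : realType} d (lambda u v : 'I_d -> R) (e : R) :
  (forall i, 0 < lambda i <= 1) -> (forall i, `|u i - v i| <= e) ->
  `|\sum_(i < d) lambda i * u i - \sum_(i < d) lambda i * v i| <= d%:R * e.
Proof.
move=> l01 uv; rewrite -sumrB; apply: (le_trans (ler_norm_sum _ _ _)).
have -> : d%:R * e = \sum_(i < d) e by rewrite sumr_const card_ord mulr_natl.
apply: ler_sum => i _; have /andP[l0 l1] := l01 i.
rewrite -mulrBr normrM (gtr0_norm l0) -[leRHS]mul1r.
by rewrite ler_pM // ltW.
Qed.

Theorem theorem4 (R : realType) (d : nat) (hd : (0 < d)%N)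
  (lambda : 'I_d -> R) (phi : 'I_(2 * d).+1 -> R -> R)
  (hsys : kolmogorov_system lambda phi)
  (K : R) (hK : is_jackson_constant K)
  (Cphi : R) (hCphi : forall q, in_LipM Cphi log10_2 0 1 (phi q))
  (f : 'rV[R]_d -> R) (hf : KL lambda phi f)
  (g : R -> R) (hg : is_outer lambda phi f g)
  (Cg : R) (hCg : Cg.-lipschitz_(`[0, d%:R]) g)
  (p : nat) (hp : (0 < p)%N) (N : nat) (hN : (5 < N)%N)
  (x : 'I_p.+1 -> R) (hx : is_gll_points x) :
  (ereal_inf [set sup_norm (fun y => (f y - s y)%R)
             | s in Knet d N x (K * Cphi / p%:R `^ log10_2)]
   <= (Cg * (2 * d%:R + 1) * d%:R
       * (21 / N%:R + 3 * K * Cphi / p%:R `^ log10_2))%:E)%E.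
Proof.
have [l01 _ phi01 phi_lt _ _] := hsys; have [K0 jackson] := hK.
have [_ fE] := hg; have [x_lt _] := hx.
have d0 : 0 < d%:R :> R by rewrite ltr0n.
have N1 : (1 < N)%N by apply: leq_trans hN.
have x_inj : injective x.
  by move=> i j xij; case: (ltngtP i j) => [/x_lt|/x_lt|/val_inj //];
    rewrite xij ltxx.
have [in0 in1] : (0 : R) \in `[0, 1] /\ (1 : R) \in `[0, 1].
  by rewrite !in_itv /= !lexx ler01.
(* Jackson's theorem is used with the constant Cphi, and Delta must not vanish:
   phi is not constant, as it is strictly increasing. *)
have Cphi0 : 0 < Cphi.
  have := hCphi ord0 0 1 in0 in1.
  rewrite sub0r normrN normr1 powR1 mulr1; apply: lt_le_trans.
  by rewrite normr_gt0 subr_eq0 lt_eqF // phi_lt ?ltr01.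
have gC : {in `[0, d%:R] &, forall u v, `|g u - g v| <= Cg * `|u - v|}.
  by move=> u v uI vI; apply: (hCg (u, v)).
have Cg0 : 0 <= Cg.
  have := gC 0 d%:R; rewrite !in_itv /= !lexx ler0n => /(_ isT isT).
  move=> /(le_trans (normr_ge0 _)).
  by rewrite pmulr_lge0 // normr_gt0 sub0r oppr_eq0 gt_eqF.
set Delta := K * Cphi / p%:R `^ log10_2.
have De0 : 0 < Delta by rewrite divr_gt0 ?mulr_gt0 ?powR_gt0 ?ltr0n.
have [r r_size rP] : exists2 r : 'I_(2 * d).+1 -> {poly R},
    forall q, (size (r q) <= p.+1)%N &
    forall q t, t \in `[0, 1] -> `|phi q t - (r q).[t]| <= Delta.
  have rq (q : 'I_(2 * d).+1) : exists r : {poly R}, (size r <= p.+1)%N /\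
      forall t, t \in `[0, 1] -> `|phi q t - r.[t]| <= Delta.
    have [r ? ?] := jackson Cphi log10_2 (phi q) p (ltW Cphi0) log10_2_itv
      (hCphi q) hp.
    by exists r.
  by have [r rP] := choice rq; exists r => q; have [] := rP q.
have [ghat ghatN ghatP] := outer_approx g Cg d%:R N N1 d0 Cg0 gC.
pose L q := inner_net x Delta Delta^-1 (fun j => (r q).[x j]).
have LP q t : t \in `[0, 1] ->
    0 <= L q t <= 1 /\ `|phi q t - L q t| <= 3 * Delta.
  move=> tI; apply: inner_approx => //; last exact: rP.
  by have := phi01 q t tI; rewrite in_itv.
apply: (@ereal_inf_le_dist _ _ _ (fun y => \sum_(q < (2 * d).+1)
    ghat (\sum_(i < d) lambda i * L q (y 0 i)))).
  exists lambda, Delta^-1, (fun q j => (r q).[x j]), ghat; split=> //.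
  by rewrite invr_gt0.
move=> y yI; rewrite fE // -sumrB; apply: (le_trans (ler_norm_sum _ _ _)).
(* The first term bounds the effect of the inner networks on g, the second the
   error of the outer network. *)
pose e := Cg * (d%:R * (3 * Delta)) + Cg * (3 * d%:R / N%:R).
apply: (@le_trans _ _ (\sum_(q < (2 * d).+1) e)).
  apply: ler_sum => q _.
  have uI : \sum_(i < d) lambda i * phi q (y 0 i) \in `[0, d%:R].
    by apply: weighted_sum_itv => // i; have := phi01 q _ (yI i); rewrite in_itv.
  have vI : \sum_(i < d) lambda i * L q (y 0 i) \in `[0, d%:R].
    by apply: weighted_sum_itv => // i; have [] := LP q _ (yI i).
  apply: (le_trans (ler_distD (g (\sum_(i < d) lambda i * L q (y 0 i))) _ _)).
  apply: lerD; last exact: ghatP.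
  apply: (le_trans (gC _ _ uI vI)); rewrite ler_wpM2l //.
  by apply: weighted_sum_dist => // i; have [] := LP q _ (yI i).
rewrite sumr_const card_ord -[e *+ _]mulr_natl -natr1 natrM.
have -> : 3 * K * Cphi / p%:R `^ log10_2 = 3 * Delta by rewrite /Delta; ring.
have N0 : 0 <= N%:R^-1 :> R by rewrite invr_ge0.
rewrite -subr_ge0.
have -> : Cg * (2 * d%:R + 1) * d%:R * (21 / N%:R + 3 * Delta)
    - (2%:R * d%:R + 1) * e
  = 18 * (Cg * (2 * d%:R + 1) * d%:R * N%:R^-1) by rewrite /e; ring.
by rewrite !mulr_ge0 // addr_ge0 ?mulr_ge0.
Qed.
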